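(* For any integer $\ell\geq 3$ there exists a graph $G$ with an edge $e$ such that $\gamma_g(G)=\ell$ and $\gamma_g(G-e)=\ell+2$.
   Context: Graphs are finite, simple and undirected. A vertex dominates itself and all its neighbors. The domination game on a graph $G$ is played by two players, Dominator and Staller, who alternately choose a vertex of $G$ such that each chosen vertex dominates at least one vertex that was not dominated by the previously chosen vertices. The game ends when all vertices of $G$ are dominated. Dominator wants the total number of chosen vertices to be as small as possible, Staller wants it to be as large as possible. Assuming both play optimally, $\gamma_g(G)$ (the game domination number) is the total number of vertices chosen when Dominator moves first. $G-e$ denotes the graph obtained from $G$ by removing the edge $e$ (keeping all vertices). *)

(* Defs.v *)
From HB Require Import structures.
From mathcomp Require Import all_boot.

Set Implicit Arguments.
Unset Strict Implicit.
Unset Printing Implicit Defensive.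

HB.instance Definition _ := SemiGroup.isComLaw.Build nat minn minnA minnC.

Record sgraph := SGraph {
  vertex :> finType;
  adj : rel vertex;
  adj_sym : symmetric adj;
  adj_irrefl : irreflexive adj }.

Definition edges (G : sgraph) : {set {set G}} :=
  [set [set p.1; p.2] | p : G * G & adj p.1 p.2].

Section EdgeRemoval.
Variables (G : sgraph) (e : {set G}).

Definition del_edge_adj : rel G := fun x y => adj x y && ([set x; y] != e).

Lemma del_edge_adj_sym : symmetric del_edge_adj.
Proof. by move=> x y; rewrite /del_edge_adj adj_sym setUC. Qed.

Lemma del_edge_adj_irrefl : irreflexive del_edge_adj.
Proof. by move=> x; rewrite /del_edge_adj adj_irrefl. Qed.

Definition del_edge : sgraph := SGraph del_edge_adj_sym del_edge_adj_irrefl.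

End EdgeRemoval.

Section DominationGame.
Variable G : sgraph.
Implicit Types (S : {set G}) (v : G).

Definition closed_nbh v : {set G} := [set u | (u == v) || adj v u].

Definition dominated S : {set G} := \bigcup_(v in S) closed_nbh v.

Definition legal S v : bool := ~~ (closed_nbh v \subset dominated S).

Inductive player := Dominator | Staller.

(* Number of moves still to be made under optimal play when the vertices in S
   have been chosen and p is to move, cut off after n moves.  Every legal move
   dominates a new vertex, so the cut-off is immaterial as soon as n is at least
   the number of undominated vertices (moves_leftE), and #|G|, which bounds the
   length of any game, is a neutral default for the minimum (moves_left_le). *)
Fixpoint moves_upto (n : nat) (p : player) S : nat :=
  if n is n'.+1 then
    if [exists v, legal S v] then
      match p with
      | Dominator =>
          (\big[minn/#|G|]_(v | legal S v) moves_upto n' Staller (v |: S)).+1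
      | Staller =>
          (\max_(v | legal S v) moves_upto n' Dominator (v |: S)).+1
      end
    else 0
  else 0.

Definition moves_left (p : player) S : nat := moves_upto #|~: dominated S| p S.

Definition game_domination_number : nat := moves_left Dominator set0.

Lemma legal_card S v :
  legal S v -> #|~: dominated (v |: S)| < #|~: dominated S|.
Proof.
case/subsetPn=> u uv uS; apply/proper_card/properP; split.
  rewrite setCS; apply/bigcupsP => w wS.
  by apply: bigcup_sup; rewrite setU1r.
exists u; first by rewrite inE.
rewrite inE negbK; apply/bigcupP; exists v => //; exact: setU11.
Qed.

Lemma exists_legal S : [exists v, legal S v] = (dominated S != setT).
Proof.
apply/existsP/idP => [[v]|].
  by apply: contraNN => /eqP ->; rewrite subsetT.
rewrite -subTset => /subsetPn[u _ uS]; exists u.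
by apply/subsetPn; exists u; rewrite // inE eqxx.
Qed.

Lemma moves_upto_stable m n p S :
  #|~: dominated S| <= m -> #|~: dominated S| <= n ->
  moves_upto m p S = moves_upto n p S.
Proof.
have over k q A : #|~: dominated A| = 0 -> moves_upto k q A = 0.
  move=> /eqP; rewrite cards_eq0 -setCT (inj_eq (@setC_inj _)) => A0.
  by case: k => //= k; rewrite exists_legal A0.
elim: m n p S => [|m IHm] [|n] p S //=.
- by rewrite leqn0 => /eqP E _; exact/esym/(over n.+1).
- by move=> _; rewrite leqn0 => /eqP E; exact: (over m.+1).
move=> Sm Sn.
have E q v : legal S v -> moves_upto m q (v |: S) = moves_upto n q (v |: S).
  by move=> /legal_card Sv; apply: IHm; rewrite -ltnS (leq_trans Sv).
by case: ifP => // _; case: p; congr _.+1; apply: eq_bigr => v; apply: E.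
Qed.

Lemma moves_leftE p S :
  moves_left p S =
  if dominated S == setT then 0 else
  match p with
  | Dominator =>
      (\big[minn/#|G|]_(v | legal S v) moves_left Staller (v |: S)).+1
  | Staller => (\max_(v | legal S v) moves_left Dominator (v |: S)).+1
  end.
Proof.
rewrite /moves_left (@moves_upto_stable _ #|~: dominated S|.+1) //=.
rewrite exists_legal if_neg.
have E q v : legal S v -> moves_upto #|~: dominated S| q (v |: S) =
    moves_upto #|~: dominated (v |: S)| q (v |: S).
  by move=> /legal_card /ltnW Sv; apply: moves_upto_stable.
by case: ifP => // _; case: p; congr _.+1; apply: eq_bigr => v; apply: E.
Qed.

Lemma moves_left_le p S : moves_left p S <= #|~: dominated S|.
Proof.
have [n] := ubnP #|~: dominated S|; elim: n p S => // n IHn p S Sn.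
have step q v : legal S v -> moves_left q (v |: S) < #|~: dominated S|.
  move=> /legal_card Sv; apply: leq_ltn_trans (Sv).
  by apply: IHn; apply: leq_trans Sv _.
rewrite moves_leftE; case: ifP => // /negbT; rewrite -exists_legal.
case/existsP=> v Lv; case: p; last first.
  have gt0 : 0 < #|~: dominated S| by apply: leq_ltn_trans (legal_card Lv).
  rewrite -(prednK gt0) ltnS; apply/bigmax_leqP => w Lw.
  by rewrite -ltnS prednK //; apply: step.
apply: leq_ltn_trans (step Staller v Lv).
by rewrite (big_rem_AC _ _ _ _ (mem_index_enum v)) Lv geq_minl.
Qed.

End DominationGame.

(* Main.v *)
(* Two isolated vertices add exactly two moves to any game, since a move on one
   can be answered on the other; an isolated edge acts as a single forced move.
   If H satisfies gamma_g(H) = gamma_g(H + K_2) = l, then G = H + K_2 with its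
   isolated edge removed is H plus two isolated vertices, so the value jumps from
   l to l + 2.  The 5-cycle (l = 3) and the ladder P_2 x P_4 (l = 4) are such H,
   and adding two isolated vertices to H raises l by 2. *)
Require Import Defs.
From mathcomp Require Import all_boot.

Set Implicit Arguments.
Unset Strict Implicit.
Unset Printing Implicit Defensive.

(** * Domination, legal moves and game values compared with thresholds *)

Lemma mem_dominated (G : sgraph) (S : {set G}) u :
  (u \in dominated S) = [exists v in S, (u == v) || adj v u].
Proof.
apply/bigcupP/exists_inP => -[v vS]; first by rewrite inE; exists v.
by move=> uv; exists v; rewrite // inE.
Qed.

Lemma legalE (G : sgraph) (S : {set G}) v :
  legal S v = [exists u, ((u == v) || adj v u) && (u \notin dominated S)].
Proof.
apply/subsetPn/existsP => [[u]|[u /andP[uv uS]]].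
  by rewrite inE => uv uS; exists u; rewrite uv.
by exists u; rewrite // inE.
Qed.

Section Bounds.
Variable G : sgraph.
Implicit Types (S : {set G}) (v : G).

Lemma moves_left_le0 p S : (moves_left p S <= 0) = (dominated S == setT).
Proof. by rewrite moves_leftE; case: ifP => // _; case: p. Qed.

(** Against a threshold the minimum over moves becomes an existential, which transfers easily
    between graphs. *)
Lemma Dominator_leS S k :
  (moves_left Dominator S <= k.+1) =
  (dominated S == setT)
    || [exists v, legal S v && (moves_left Staller (v |: S) <= k)].
Proof.
rewrite moves_leftE; case: ifP => //= ndom; rewrite ltnS.
apply/idP/existsP => [minle|[v /andP[Lv vk]]]; last first.
  apply: leq_trans vk.
  by rewrite (big_rem_AC _ _ _ _ (mem_index_enum v)) Lv geq_minl.
have [v Lv] : exists v, legal S v by apply/existsP; rewrite exists_legal ndom.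
apply/existsP; apply: contraLR minle => /existsPn no_move.
rewrite -ltnNge; elim/big_ind: _ => [|m n|w Lw]; last 2 first.
- by rewrite leq_min => -> ->.
- by move: (no_move w); rewrite Lw -ltnNge.
(* The default [#|G|] of the minimum exceeds [k] too, since it bounds the value after the legal move
   [v]. *)
move: (no_move v); rewrite Lv -ltnNge => /leq_trans; apply.
by apply: leq_trans (moves_left_le _ _) (max_card _).
Qed.

(** The finished game needs no separate disjunct: without legal moves the condition holds
    vacuously. *)
Lemma Staller_leS S k :
  (moves_left Staller S <= k.+1) =
  [forall v, legal S v ==> (moves_left Dominator (v |: S) <= k)].
Proof.
rewrite moves_leftE; case: ifP => [dom|_].
  apply/esym/forallP => v; apply/implyP => Lv.
  have: [exists v, legal S v] by apply/existsP; exists v.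
  by rewrite exists_legal dom.
rewrite ltnS; apply/bigmax_leqP/forallP => [le v|le v]; apply/implyP; exact: le.
Qed.

End Bounds.

(** Turns equalities of game values into inductions on the threshold. *)
Lemma eqn_leq_iff (m n : nat) : (forall k, (m <= k) = (n <= k)) -> m = n.
Proof. by move=> E; apply/eqP; rewrite eqn_leq E leqnn -E leqnn. Qed.

(** * Adding two vertices, joined or isolated, to a graph *)

Definition pair_adj (b : bool) (H : sgraph) : rel (H + bool) :=
  fun u v => match u, v with
  | inl x, inl y => adj x y
  | inr i, inr j => b && (i != j)
  | _, _ => false
  end.

Lemma pair_adj_sym b H : symmetric (@pair_adj b H).
Proof. by case=> [x|i] [y|j] //=; [exact: adj_sym | rewrite eq_sym]. Qed.

Lemma pair_adj_irrefl b H : irreflexive (@pair_adj b H).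
Proof. by case=> [x|i] /=; rewrite ?adj_irrefl // eqxx andbF. Qed.

Definition add_pair b H : sgraph :=
  SGraph (@pair_adj_sym b H) (@pair_adj_irrefl b H).

Section IsolatedPair.
(** [K] is given through a relabelling [g], because the result is applied to a graph with a deleted
    edge and to a graph whose pairs come in another order. *)
Variables (H K : sgraph) (g : H + bool -> K).
Hypothesis g_bij : bijective g.
Hypothesis g_adj : forall u v, adj (g u) (g v) = @pair_adj false H u v.
Implicit Types (S : {set K}) (x : H) (i : bool).

Let trace S : {set H} := [set x | g (inl x) \in S].
Let g_inj : injective g := bij_inj g_bij.

Lemma trace_inl S x : trace (g (inl x) |: S) = x |: trace S.
Proof. by apply/setP => y; rewrite !inE (inj_eq g_inj). Qed.

Lemma trace_inr S i : trace (g (inr i) |: S) = trace S.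
Proof. by apply/setP => y; rewrite !inE (inj_eq g_inj). Qed.

Lemma exists_bij (P : pred K) :
  [exists v, P v] = [exists x, P (g (inl x))] || [exists i, P (g (inr i))].
Proof.
have [h gK hK] := g_bij.
apply/existsP/orP => [[v]|[] /existsP[x Px]]; try by eexists; exact: Px.
by rewrite -(hK v); case: (h v) => x Px; [left|right]; apply/existsP; exists x.
Qed.

(** The isolated vertices dominate nothing in [H], so only the trace matters. *)
Lemma dominated_inl S x : (g (inl x) \in dominated S) = (x \in dominated (trace S)).
Proof.
rewrite !mem_dominated exists_bij orbC orb_idl => [|/existsP[i]].
  by apply: eq_existsb => y; rewrite inE (inj_eq g_inj) g_adj.
by rewrite (inj_eq g_inj) g_adj andbF.
Qed.

Lemma dominated_inr S i : (g (inr i) \in dominated S) = (g (inr i) \in S).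
Proof.
rewrite mem_dominated; apply/exists_inP/idP => [[v vS]|iS]; last first.
  by exists (g (inr i)); rewrite ?eqxx.
have [h gK hK] := g_bij; rewrite -(hK v) (inj_eq g_inj) g_adj in vS *.
by case: (h v) vS => [//|j] vS /=; rewrite orbF => /eqP[->].
Qed.

Lemma legal_inl S x : legal S (g (inl x)) = legal (trace S) x.
Proof.
rewrite !legalE exists_bij orbC orb_idl => [|/existsP[i]].
  by apply: eq_existsb => y; rewrite (inj_eq g_inj) g_adj dominated_inl.
by rewrite (inj_eq g_inj) g_adj.
Qed.

Lemma legal_inr S i : legal S (g (inr i)) = (g (inr i) \notin S).
Proof.
rewrite legalE; apply/existsP/idP => [[v]|iS]; last first.
  by exists (g (inr i)); rewrite eqxx dominated_inr.
have [h gK hK] := g_bij; rewrite -(hK v) (inj_eq g_inj) g_adj.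
by case: (h v) => [//|j] /=; rewrite orbF => /andP[/eqP[->]]; rewrite dominated_inr.
Qed.

Lemma dominated_full S :
  (dominated S == setT) =
  (dominated (trace S) == setT) && [forall i, g (inr i) \in S].
Proof.
rewrite -!subTset; apply/subsetP/andP => [full|[/subsetP fullH /forallP full] v _].
  split; first by apply/subsetP => x _; rewrite -dominated_inl full.
  by apply/forallP => i; rewrite -dominated_inr full.
have [h gK hK] := g_bij; rewrite -(hK v).
by case: (h v) => x; rewrite ?dominated_inl ?dominated_inr ?fullH ?inE.
Qed.

Lemma forall_bij (P : pred K) :
  [forall v, P v] = [forall x, P (g (inl x))] && [forall i, P (g (inr i))].
Proof.
have [h gK hK] := g_bij.
apply/forallP/andP => [PK|[/forallP Pl /forallP Pr] v].
  by split; apply/forallP => x; exact: PK.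
by rewrite -(hK v); case: (h v).
Qed.

(** The chosen pair offers no further legal move, so play continues as in [H] alone. *)
Lemma moves_left_pair_chosen p S :
  (forall i, g (inr i) \in S) -> moves_left p S = moves_left p (trace S).
Proof.
move=> iS; apply: eqn_leq_iff => k; elim: k p S iS => [|k IHk] p S iS.
  rewrite !moves_left_le0 dominated_full andb_idr // => _; exact/forallP.
have step q x : (moves_left q (g (inl x) |: S) <= k) =
                (moves_left q (x |: trace S) <= k).
  by rewrite IHk ?trace_inl // => i; rewrite setU1r.
case: p.
  rewrite !Dominator_leS dominated_full (introT forallP iS) andbT exists_bij.
  congr (_ || _); rewrite orbC orb_idl => [|/existsP[i]].
    by apply: eq_existsb => x; rewrite legal_inl step.
  by rewrite legal_inr iS.
rewrite !Staller_leS forall_bij andb_idr => [|_].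
  by apply: eq_forallb => x; rewrite legal_inl step.
by apply/forallP => i; rewrite legal_inr iS.
Qed.

Lemma pair_chosen i S j : g (inr j) \in g (inr (~~ i)) |: (g (inr i) |: S).
Proof. by rewrite !inE !(inj_eq g_inj); case: i j => -[]; rewrite eqxx ?orbT. Qed.

Lemma dominated_fullF S i : g (inr i) \notin S -> (dominated S == setT) = false.
Proof.
by move=> iS; rewrite dominated_full; apply/negP => /andP[_ /forallP/(_ i)/(negP iS)].
Qed.

Lemma inr_notin_setU1 S u i :
  g (inr i) \notin S -> g (inr i) != u -> g (inr i) \notin u |: S.
Proof. by move=> iS iu; rewrite !inE negb_or iu. Qed.

(** Each isolated vertex is dominated only by itself, so two moves are still due. *)
Lemma pair_gt1 p S : (forall i, g (inr i) \notin S) -> (moves_left p S <= 1) = false.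
Proof.
move=> iS; have nodom i u : g (inr i) != u -> (dominated (u |: S) == setT) = false.
  by move=> iu; apply: (@dominated_fullF _ i); exact: inr_notin_setU1.
apply/negP; case: p.
  rewrite Dominator_leS (dominated_fullF (iS true)) /= => /existsP[v /andP[_]].
  rewrite moves_left_le0; have [<-|vt] := eqVneq (g (inr true)) v.
    by rewrite (nodom false) // (inj_eq g_inj).
  by rewrite (nodom true).
rewrite Staller_leS => /forallP/(_ (g (inr true))).
by rewrite legal_inr iS moves_left_le0 (nodom false) // (inj_eq g_inj).
Qed.

(** At most the two isolated vertices remain undominated, and every move dominates a new vertex. *)
Lemma pair_le2 p S : dominated (trace S) == setT -> moves_left p S <= 2.
Proof.
move=> /eqP full; apply: leq_trans (moves_left_le _ _) _.
apply: leq_trans (_ : #|[set g (inr true); g (inr false)]| <= 2); last first.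
  by rewrite cards2 (inj_eq g_inj).
apply/subset_leq_card/subsetP => v; rewrite inE.
have [h gK hK] := g_bij; rewrite -(hK v).
case: (h v) => [x|[]]; first by rewrite dominated_inl full inE.
  by rewrite !inE eqxx.
by rewrite !inE eqxx orbT.
Qed.

(** Either player can answer a move on the pair by the other vertex of the pair, which costs two
    moves and restores the position of [H] with the same player to move. Thresholds 0 and 1 fail by
    [pair_gt1]; above them the induction compares [k.+2] with [k]. *)
Lemma moves_left_pair_unchosen p S :
  (forall i, g (inr i) \notin S) -> moves_left p S = (moves_left p (trace S)).+2.
Proof.
move=> iS; apply: eqn_leq_iff => -[|[|k]].
- exact/negbTE/(contraFN _ (pair_gt1 p iS))/leqW.
- exact: pair_gt1.
have inlS x S' : (forall i, g (inr i) \notin S') ->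
    forall i, g (inr i) \notin g (inl x) |: S'.
  by move=> iS' i; apply: inr_notin_setU1; rewrite // (inj_eq g_inj).
have answer S' i : (forall i, g (inr i) \notin S') ->
    legal (g (inr i) |: S') (g (inr (~~ i))).
  move=> iS'; rewrite legal_inr inr_notin_setU1 // (inj_eq g_inj).
  by case: i.
have both q i S' : moves_left q (g (inr (~~ i)) |: (g (inr i) |: S')) =
    moves_left q (trace S').
  by rewrite moves_left_pair_chosen ?trace_inr // => j; exact: pair_chosen.
(* Dominator gains nothing by opening the pair, as Staller closes it at once. *)
have Staller_answers S' i n : (forall i, g (inr i) \notin S') ->
    moves_left Staller (g (inr i) |: S') <= n.+1 ->
    moves_left Dominator (trace S') <= n.
  move=> iS'; rewrite Staller_leS => /forallP/(_ (g (inr (~~ i)))).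
  by rewrite answer // both.
rewrite !ltnS; elim: k p S iS => [|k IHk] p S iS.
  rewrite moves_left_le0; apply/idP/idP => [|/pair_le2 -> //]; case: p.
    rewrite Dominator_leS (dominated_fullF (iS true)) exists_bij /=.
    case/orP=> /existsP[v /andP[_]]; first by rewrite pair_gt1 //; exact: inlS.
    by move=> /Staller_answers; rewrite moves_left_le0; exact.
  (* Staller opens the pair; Dominator's single remaining move cannot both finish [H] and close the
     pair, so [H] is already dominated. *)
  rewrite Staller_leS => /forallP/(_ (g (inr true))).
  rewrite legal_inr iS Dominator_leS dominated_full trace_inr /=.
  case/orP=> [/andP[] // | /existsP[v /andP[_]]].
  rewrite moves_left_le0; have [h gK hK] := g_bij; rewrite -(hK v).
  case: (h v) => [x|j]; last by rewrite dominated_full !trace_inr => /andP[].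
  rewrite (@dominated_fullF _ false) //; do 2?apply: inr_notin_setU1 => //.
    by rewrite (inj_eq g_inj).
  by rewrite (inj_eq g_inj).
have step q x : (moves_left q (g (inl x) |: S) <= k.+2) =
    (moves_left q (x |: trace S) <= k).
  by rewrite IHk ?trace_inl //; exact: inlS.
case: p.
  apply/idP/idP => [|]; rewrite [in X in X -> _]Dominator_leS.
    rewrite (dominated_fullF (iS true)) exists_bij /=.
    case/orP=> /existsP[v /andP[Lv]]; last exact: Staller_answers.
    rewrite step Dominator_leS => le; apply/orP; right; apply/existsP; exists v.
    by rewrite -legal_inl Lv.
  case/orP=> [/pair_le2 le2|/existsP[x]]; first exact: leq_trans (le2 _) _.
  rewrite -legal_inl -step => le; rewrite Dominator_leS exists_bij.
  by apply/orP; right; apply/orP; left; apply/existsP; exists x.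
rewrite !Staller_leS forall_bij andb_idr => [|le].
  by apply: eq_forallb => x; rewrite legal_inl step.
(* If Staller opens the pair, Dominator closes it; Staller then faces the same position of [H],
   which [le] covers. *)
apply/forallP => i; apply/implyP => _; rewrite Dominator_leS.
apply/orP; right; apply/existsP; exists (g (inr (~~ i))).
rewrite answer // both /= Staller_leS; apply/forallP => x.
by move/forallP: le => /(_ x); rewrite legal_inl step.
Qed.

End IsolatedPair.

Lemma game_isolated_pair (H K : sgraph) (g : H + bool -> K) :
  bijective g -> (forall u v, adj (g u) (g v) = pair_adj false u v) ->
  game_domination_number K = game_domination_number H + 2.
Proof.
move=> g_bij g_adj; rewrite /game_domination_number.
rewrite (moves_left_pair_unchosen g_bij g_adj) => [|i]; last by rewrite inE.
by rewrite addn2; congr (moves_left _ _).+2; apply/setP => x; rewrite !inE.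
Qed.

(** * Evaluating the game by computation on lists *)

(* U lists the vertices not yet dominated, s the candidate moves. *)
Fixpoint game_le (G : sgraph) (s : seq G) (k : nat) (p : player) (U : seq G) :=
  let nbh v := [pred u | (u == v) || adj v u] in
  let play n q v := game_le s n q [seq u <- U | ~~ nbh v u] in
  if k is n.+1 then
    match p with
    | Dominator => nilp U || has (fun v => has (nbh v) U && play n Staller v) s
    | Staller => all (fun v => has (nbh v) U ==> play n Dominator v) s
    end
  else nilp U.

Lemma nilp_undominated (G : sgraph) (S : {set G}) (U : seq G) :
  U =i ~: dominated S -> nilp U = (dominated S == setT).
Proof.
move=> US; rewrite -(inj_eq (@setC_inj _)) setCT.
apply/nilP/eqP => [nilU|full]; first by apply/setP => v; rewrite -US nilU !inE.
by case: U US => // u U /(_ u); rewrite full !inE eqxx.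
Qed.

(** Filtering out the closed neighborhood of a move mirrors the growth of the dominated set; [U]
    matters only up to membership. *)
Lemma game_leP (G : sgraph) (s U : seq G) k p (S : {set G}) :
  (forall v, v \in s) -> U =i ~: dominated S ->
  (moves_left p S <= k) = game_le s k p U.
Proof.
move=> s_all; elim: k p S U => [|k IHk] p S U US.
  by rewrite moves_left_le0 /= (nilp_undominated US).
have Lv v : legal S v = has [pred u | (u == v) || adj v u] U.
  rewrite legalE; apply/existsP/hasP => [[u /andP[vu uS]]|[u uU vu]]; exists u => //.
    by rewrite US inE.
  by rewrite -[_ || _]/([pred u | (u == v) || adj v u] u) vu; rewrite US inE in uU.
have play v q : (moves_left q (v |: S) <= k) =
    game_le s k q [seq u <- U | ~~ [pred u | (u == v) || adj v u] u].
  apply: IHk => u; rewrite mem_filter US !inE !mem_dominated -negb_or; congr (~~ _).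
  apply/orP/exists_inP => [[uv|/exists_inP[w wS uw]]|[w]].
  - by exists v; rewrite ?setU11.
  - by exists w; rewrite ?setU1r.
  by rewrite !inE => /predU1P[->|wS uw]; [left|right; apply/exists_inP; exists w].
case: p => /=.
  rewrite Dominator_leS (nilp_undominated US); congr (_ || _).
  apply/existsP/hasP => [[v]|[v _]]; first by rewrite Lv play; exists v.
  by rewrite -Lv -play; exists v.
rewrite Staller_leS; apply/forallP/allP => vP v; last by rewrite Lv play vP.
by move=> _; rewrite -Lv -play.
Qed.

(** At the start nothing is dominated, so [s] serves both as the moves and as the undominated
    vertices. *)
Lemma game_domination_numberP (G : sgraph) (s : seq G) l :
  (forall v, v \in s) ->
  game_le s l.+1 Dominator s && ~~ game_le s l Dominator s ->
  game_domination_number G = l.+1.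
Proof.
move=> s_all; have s_eq : s =i ~: dominated (set0 : {set G}).
  by move=> v; rewrite s_all inE mem_dominated; apply/esym/exists_inP => -[w]; rewrite inE.
by rewrite -!(game_leP _ _ s_all s_eq) -ltnNge => /andP[le lt]; apply/eqP; rewrite eqn_leq le.
Qed.

(** * Concrete graphs with computable vertex lists *)

Section EdgeList.
Variables (n : nat) (E : seq (nat * nat)).

Definition edge_list_adj : rel 'I_n := fun i j =>
  (i != j) && (((val i, val j) \in E) || ((val j, val i) \in E)).

Lemma edge_list_adj_sym : symmetric edge_list_adj.
Proof. by move=> i j; rewrite /edge_list_adj eq_sym orbC. Qed.

Lemma edge_list_adj_irrefl : irreflexive edge_list_adj.
Proof. by move=> i; rewrite /edge_list_adj eqxx. Qed.

Definition edge_list_graph := SGraph edge_list_adj_sym edge_list_adj_irrefl.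

End EdgeList.

(* [ord_enum] does not compute, because [insub] is blocked by an opaque proof. *)
Definition computable_ords n : seq 'I_n := pmap (insub_eq _) (iota 0 n).

Lemma mem_computable_ords n (i : 'I_n) : i \in computable_ords n.
Proof.
by rewrite /computable_ords (eq_pmap (insub_eqE _)) -/(ord_enum n) mem_ord_enum.
Qed.

Definition with_pair (T : Type) (s : seq T) : seq (T + bool) :=
  [:: inr true, inr false & map inl s].

Lemma mem_with_pair (T : eqType) (s : seq T) :
  (forall x, x \in s) -> forall v, v \in with_pair s.
Proof.
move=> s_all [x|[]] //.
by rewrite !inE /= mem_map // => y z [].
Qed.

(** * Graphs whose game value is unchanged by an added [K_2] *)

Definition absorbs_pair l (H : sgraph) : Prop :=
  game_domination_number H = l /\ game_domination_number (add_pair true H) = l.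

Definition cycle5 : sgraph :=
  edge_list_graph 5 [:: (0, 1); (1, 2); (2, 3); (3, 4); (4, 0)].

(** The paths are 0 to 3 and 4 to 7, with rungs joining [i] to [i + 4]. *)
Definition ladder4 : sgraph := edge_list_graph 8
  [:: (0, 1); (1, 2); (2, 3); (4, 5); (5, 6); (6, 7);
      (0, 4); (1, 5); (2, 6); (3, 7)].

Lemma cycle5_absorbs_pair : absorbs_pair 3 cycle5.
Proof.
have s_all := @mem_computable_ords 5; split.
  by apply: (@game_domination_numberP cycle5 _ _ s_all); vm_compute.
by apply: (@game_domination_numberP (add_pair true cycle5) _ _
  (mem_with_pair s_all)); vm_compute.
Qed.

Lemma ladder4_absorbs_pair : absorbs_pair 4 ladder4.
Proof.
have s_all := @mem_computable_ords 8; split.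
  by apply: (@game_domination_numberP ladder4 _ _ s_all); vm_compute.
by apply: (@game_domination_numberP (add_pair true ladder4) _ _
  (mem_with_pair s_all)); vm_compute.
Qed.

Lemma absorbs_pair_step l H :
  absorbs_pair l H -> absorbs_pair (l + 2) (add_pair false H).
Proof.
move=> [Hl HKl]; split.
  by rewrite (@game_isolated_pair H (add_pair false H) id) ?Hl //; exists id.
(* Exchanging the two pairs makes the isolated one outermost, so that it can be split off from
   [add_pair true H]. *)
pose swap (u : (H + bool) + bool) : (H + bool) + bool :=
  match u with
  | inl (inl x) => inl (inl x)
  | inl (inr i) => inr i
  | inr i => inl (inr i)
  end.
rewrite (@game_isolated_pair (add_pair true H) (add_pair true (add_pair false H)) swap).
- by rewrite HKl.
- by exists swap => -[[]|].
- by move=> [[x|i]|i] [[y|j]|j].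
Qed.

Lemma exists_absorbs_pair l : 3 <= l -> exists H, absorbs_pair l H.
Proof.
elim/ltn_ind: l => -[|[|[|[|[|l]]]]] // IH _.
- by exists cycle5; exact: cycle5_absorbs_pair.
- by exists ladder4; exact: ladder4_absorbs_pair.
(* Steps have size two, hence the two base values 3 and 4. *)
have [|//|H Hl] := IH l.+3; first by rewrite !ltnS leqnSn.
by exists (add_pair false H); rewrite -addn2; exact: absorbs_pair_step.
Qed.

Theorem proposition2p2 (l : nat) (hl : 3 <= l) :
  exists (G : sgraph) (e : {set G}),
    [/\ e \in edges G,
        game_domination_number G = l
      & game_domination_number (del_edge e) = l + 2].
Proof.
have [H [Hl HKl]] := exists_absorbs_pair hl.
pose G := add_pair true H.
pose a : G := inr true; pose b : G := inr false.
exists G, [set a; b]; split=> //; first by apply/imsetP; exists (a, b); rewrite ?inE.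
rewrite (@game_isolated_pair H (del_edge [set a; b]) id) ?Hl //; first by exists id.
(* The deleted edge avoids [H], and it is the only edge of the pair. *)
case=> [x|i] [y|j] //=; rewrite /del_edge_adj /=.
  rewrite [X in _ && X](_ : _ = true) ?andbT //; apply/eqP => /setP/(_ (inl x)).
  by rewrite !inE eqxx.
by case: i j => -[] //=; rewrite /a /b ?eqxx // setUC eqxx.
Qed.
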